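(* Let $\mathbb{S}$ be either $\mathbb{R}_+=[0,\infty)$ or $\mathbb{N}_0$, let $H\neq\{0\}$ be a Hilbert space, let $\vartheta=(\vartheta_t)_{t\in\mathbb{S}}$ be an $E_0$-semigroup of normal unital endomorphisms of $\mathcal{B}(H)$, and let $\xi\in H$ be a unit vector. Then the Arveson system ${E^A}^\otimes$ associated with $\vartheta$ and the Bhat system ${E^B}^\otimes$ associated with $\vartheta$ (based on $\xi$) are anti-isomorphic: there is a family of unitaries $u'_t\colon E^A_t\to E^B_t$, $t\in\mathbb{S}$, such that $u'_{t+s}(x'_ty'_s)=(u'_sy'_s)(u'_tx'_t)$ for all $s,t\in\mathbb{S}$, $x'_t\in E^A_t$, $y'_s\in E^A_s$, where the product on the left-hand side is that of ${E^A}^\otimes$ and the product on the right-hand side is that of ${E^B}^\otimes$.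
   Context: All Hilbert spaces are complex, with inner product linear in the second variable. $\mathcal{B}(H)$ is the algebra of bounded operators on $H$. For $x,y\in H$, $xy^*$ denotes the rank-one operator $z\mapsto x\langle y,z\rangle$. $E_0$-semigroup on $\mathcal{B}(H)$: a family $\vartheta=(\vartheta_t)_{t\in\mathbb{S}}$ of normal unital $*$-endomorphisms of $\mathcal{B}(H)$ with $\vartheta_0=\mathrm{id}$ and $\vartheta_s\circ\vartheta_t=\vartheta_{s+t}$ (no continuity in $t$ is required). Arveson system associated with $\vartheta$: the family of Hilbert spaces $E^A_t:=\{x'_t\in\mathcal{B}(H):\vartheta_t(a)x'_t=x'_ta\ \text{for all } a\in\mathcal{B}(H)\}$ with inner product determined by $\langle x'_t,y'_t\rangle\mathrm{id}_H={x'_t}^*y'_t$, and product $E^A_t\times E^A_s\to E^A_{t+s}$ given by composition of operators, $(x'_t,y'_s)\mapsto x'_ty'_s$. Bhat system associated with $\vartheta$ based on the unit vector $\xi$: the family of Hilbert subspaces $E^B_t:=\vartheta_t(\xi\xi^* )H$ of $H$ with product $E^B_s\times E^B_t\to E^B_{s+t}$, $(x_s,y_t)\mapsto x_sy_t:=\vartheta_t(x_s\xi^* )y_t$. In both cases the products are associative and induce unitaries $E^A_t\otimes E^A_s\to E^A_{t+s}$ and $E^B_s\otimes E^B_t\to E^B_{s+t}$. *)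

(* Defs.v *)
From HB Require Import structures.
From mathcomp Require Import all_boot all_order all_algebra.
From mathcomp Require Import complex ring lra.
From mathcomp Require Import boolp classical_sets functions reals topology normedtype.
Set Implicit Arguments. Unset Strict Implicit. Unset Printing Implicit Defensive.
Import Order.TTheory GRing.Theory Num.Theory.
Import numFieldNormedType.Exports.
Local Open Scope classical_set_scope.
Local Open Scope complex_scope.
Local Open Scope ring_scope.

(* A complex Hilbert space is a Banach space over [R[i]] whose norm comes from an
   inner product; the inner product is linear in the second variable. *)
HB.mixin Record CompleteNormedModule_isHilbert (R : realType) H
    & CompleteNormedModule R[i] H := {
  inner : H -> H -> R[i];
  inner_conj : forall x y, inner y x = Num.conj (inner x y);
  inner_linear : forall x a y z, inner x (a *: y + z) = a * inner x y + inner x z;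
  inner_norm : forall x, inner x x = `|x| ^+ 2
}.

#[short(type="hilbertType")]
HB.structure Definition Hilbert (R : realType) :=
  {H of CompleteNormedModule_isHilbert R H & CompleteNormedModule R[i] H}.

Notation "''[' x , y ]" := (inner x y) : ring_scope.

Section InnerTheory.
Variables (R : realType) (H : hilbertType R).
Implicit Types (x y z : H) (a : R[i]).

Lemma innerDr x y z : '[x, y + z] = '[x, y] + '[x, z].
Proof. by rewrite -{1}(scale1r y) inner_linear mul1r. Qed.
Lemma inner0r x : '[x, 0] = 0.
Proof. by apply: (addrI '[x, 0]); rewrite -innerDr !addr0. Qed.
Lemma innerZr x a y : '[x, a *: y] = a * '[x, y].
Proof. by rewrite -{1}(addr0 (_ *: _)) inner_linear inner0r addr0. Qed.
Lemma innerNr x y : '[x, - y] = - '[x, y].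
Proof. by rewrite -scaleN1r innerZr mulN1r. Qed.
Lemma innerBr x y z : '[x, y - z] = '[x, y] - '[x, z].
Proof. by rewrite innerDr innerNr. Qed.
Lemma innerDl x y z : '[y + z, x] = '[y, x] + '[z, x].
Proof. by rewrite inner_conj innerDr rmorphD /= -!inner_conj. Qed.
Lemma inner0l x : '[0, x] = 0.
Proof. by rewrite inner_conj inner0r conjC0. Qed.
Lemma innerZl x a y : '[a *: y, x] = Num.conj a * '[y, x].
Proof. by rewrite inner_conj innerZr rmorphM /= -inner_conj. Qed.
Lemma innerNl x y : '[- y, x] = - '[y, x].
Proof. by rewrite inner_conj innerNr rmorphN /= -inner_conj. Qed.
Lemma innerBl x y z : '[y - z, x] = '[y, x] - '[z, x].
Proof. by rewrite innerDl innerNl. Qed.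

Lemma inner_ge0 x : 0 <= '[x, x].
Proof. by rewrite inner_norm exprn_ge0. Qed.

Lemma cauchy_schwarz x y : `|'[x, y]| <= `|x| * `|y|.
Proof.
have [->|x0] := eqVneq x 0; first by rewrite inner0l !normr0 mul0r.
have xp : 0 < `|x| ^+ 2 by rewrite exprn_gt0 // normr_gt0.
rewrite -(@ler_pXn2r _ 2) // ?nnegrE ?mulr_ge0 //.
have := inner_ge0 ('[x, x] *: y - '[x, y] *: x).
rewrite innerBr !innerZr !innerBl !innerZl -!inner_conj.
have -> : '[x, y] * ('[x, x] * '[y, x] - '[y, x] * '[x, x]) = 0 by ring.
rewrite subr0 inner_norm (inner_norm y).
rewrite pmulr_rge0 // (inner_conj x y) mulrC -normCKC exprMn subr_ge0.
by rewrite [X in _ <= X]mulrC.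
Qed.

Lemma inner_eq x y : (forall z, '[z, x] = '[z, y]) -> x = y.
Proof.
move=> E; apply/subr0_eq/eqP; rewrite -normr_eq0 -sqrf_eq0 -inner_norm.
by rewrite innerBr E subrr.
Qed.

Lemma inner_eql x y : (forall z, '[x, z] = '[y, z]) -> x = y.
Proof. by move=> E; apply: inner_eq => z; rewrite inner_conj E -inner_conj. Qed.

End InnerTheory.

Local Notation Re := complex.Re.
Local Notation Im := complex.Im.
Section Riesz.
Variables (R : realType) (H : hilbertType R) (f : H -> R[i]) (k : R[i]).
Hypothesis f_lin : forall a x y, f (a *: x + y) = a * f x + f y.
Hypothesis f_bnd : forall x, `|f x| <= k * `|x|.

Let N (x : H) : R := Re `|x|.
Let NE x : `|x| = (N x)%:C.
Proof. by rewrite RRe_real // ger0_real. Qed.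
Let N_ge0 x : 0 <= N x. Proof. by rewrite -ler0c -NE. Qed.
Let ip (x y : H) : R := Re '[x, y].
Let g (x : H) : R := Re (f x).
Let ReD (u v : R[i]) : Re (u + v) = Re u + Re v. Proof. by case: u v => ? ? []. Qed.
Let ReZ (t : R) (u : R[i]) : Re (t%:C * u) = t * Re u.
Proof. by case: u => a b /=; rewrite mul0r subr0. Qed.
Let ReJ (u : R[i]) : Re (Num.conj u) = Re u. Proof. by case: u. Qed.
Let Re_le (u v : R[i]) : u <= v -> Re u <= Re v. Proof. by rewrite lecE => /andP[]. Qed.
Let Re_norm (u : R[i]) : `|Re u| <= Re `|u|.
Proof. by have := normc_ge_Re u; rewrite lecE /= => /andP[]. Qed.

Let ipC x y : ip x y = ip y x. Proof. by rewrite /ip inner_conj ReJ. Qed.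
Let ipD x y z : ip x (y + z) = ip x y + ip x z.
Proof. by rewrite /ip innerDr ReD. Qed.
Let ipZ x t z : ip x (t%:C *: z) = t * ip x z.
Proof. by rewrite /ip innerZr ReZ. Qed.
Let ipxx x : ip x x = N x ^+ 2.
Proof. by rewrite /ip inner_norm NE -rmorphXn. Qed.
Let gD x y : g (x + y) = g x + g y.
Proof. by rewrite /g -(scale1r x) f_lin mul1r ReD scale1r. Qed.
Let f0 : f 0 = 0.
Proof. by apply: (addrI (f 0)); have := f_lin 1 0 0; rewrite scale1r mul1r !addr0. Qed.
Let fZ a x : f (a *: x) = a * f x.
Proof. by have := f_lin a x 0; rewrite !addr0 f0 addr0. Qed.
Let gZ t z : g (t%:C *: z) = t * g z.
Proof. by rewrite /g fZ ReZ. Qed.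
Let ip_cs x y : `|ip x y| <= N x * N y.
Proof.
apply: (le_trans (Re_norm _)); apply: (le_trans (Re_le (cauchy_schwarz x y))).
by rewrite !NE -rmorphM.
Qed.
Let g_bnd x : `|g x| <= Re k * N x.
Proof.
apply: (le_trans (Re_norm _)); apply: (le_trans (Re_le (f_bnd x))).
by rewrite NE mulrC ReZ mulrC.
Qed.

Let Q x : R := N x ^+ 2 - 2 * g x.
Let QE x t h : Q (x + t%:C *: h) = Q x + 2 * t * (ip x h - g h) + t ^+ 2 * N h ^+ 2.
Proof.
rewrite /Q -!ipxx ipD ipZ ipC ipD ipZ [ip (_ + _) h]ipC ipD ipZ gD gZ (ipC h x).
ring.
Qed.
Let Q_lb x : - Re k ^+ 2 <= Q x.
Proof.
rewrite /Q; have := g_bnd x; rewrite ler_norml => /andP[_ gx].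
have := sqr_ge0 (N x - Re k); nra.
Qed.
Let m : R := inf (range Q).
Let has_infQ : has_inf (range Q).
Proof.
split; first by exists (Q 0), 0.
by exists (- Re k ^+ 2) => _ [x _ <-].
Qed.
Let Q_ge x : m <= Q x.
Proof. by apply: ge_inf; [case: has_infQ | exists x]. Qed.
Let Q_ex (e : R) : 0 < e -> exists x, Q x < m + e.
Proof.
move=> e0; have [_ [x _ <-]] := inf_adherent e0 has_infQ; by exists x.
Qed.
Let Qxy x y : N (x - y) ^+ 2 <= 2 * (Q x - m) + 2 * (Q y - m).
Proof.
have h := QE y 1 (x - y); have h2 := QE y (2^-1) (x - y).
have q : m <= Q (y + (2^-1)%:C *: (x - y)) by exact: Q_ge.
rewrite scale1r addrCA subrr addr0 in h.
lra.
Qed.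

Let quad x h : (ip x h - g h) ^+ 2 <= N h ^+ 2 * (Q x - m).
Proof.
set a := ip x h - g h.
have [h0|hn0] := eqVneq (N h ^+ 2) 0.
  have q t : m <= Q x + 2 * t * a.
    by have := Q_ge (x + t%:C *: h); rewrite QE h0 mulr0 addr0.
  rewrite h0 mul0r; have [->|a0] := eqVneq a 0; first by rewrite expr0n.
  have := q (- (Q x - m + 1) / (2 * a)).
  have -> : 2 * (- (Q x - m + 1) / (2 * a)) * a = - (Q x - m + 1) by field.
  lra.
have hp : 0 < N h ^+ 2 by rewrite lt_def hn0 sqr_ge0.
have := Q_ge (x + (- a / N h ^+ 2)%:C *: h); rewrite QE -/a => q.
rewrite -subr_ge0 -(@pmulr_rge0 _ (N h ^+ 2)^-1) ?invr_gt0 //.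
have -> : (N h ^+ 2)^-1 * (N h ^+ 2 * (Q x - m) - a ^+ 2)
  = Q x + 2 * (- a / N h ^+ 2) * a + (- a / N h ^+ 2) ^+ 2 * N h ^+ 2 - m.
  by field; rewrite -sqrf_eq0.
by rewrite subr_ge0.
Qed.

Lemma riesz_representation : exists v : H, forall x, f x = '[v, x].
Proof.
have /choice[x_ x_P] : forall n : nat, exists x, Q x < m + n.+1%:R^-1.
  by move=> n; apply: Q_ex; rewrite invr_gt0.
pose F := x_ @ \oo.
have Fc : cauchy F.
  apply: cauchy_exP => e; rewrite ltcE /= => /andP[/eqP ei e0].
  have eE : e = (Re e)%:C by rewrite [LHS]complexE ei mulr0 addr0.
  set d := Re e in e0 eE.
  have [n nP] : exists n : nat, n.+1%:R^-1 < d ^+ 2 / 4.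
    have d2 : 0 < d ^+ 2 / 4 by rewrite divr_gt0 ?exprn_gt0.
    by have [n] := ltr_add_invr d2; rewrite add0r; exists n.
  exists (x_ n); exists n => //= j /= nj.
  rewrite -ball_normE /= eE NE ltcR -(@ltr_pXn2r _ 2) ?nnegrE ?N_ge0 ?ltW //.
  apply: le_lt_trans (Qxy _ _) _.
  have jn : j.+1%:R^-1 <= n.+1%:R^-1 :> R by rewrite lef_pV2 ?posrE ?ler_nat.
  have := x_P n; have := x_P j; move: nP jn; move: (n.+1%:R^-1) (j.+1%:R^-1) => p1 p2; lra.
have [v vP] := proj1 (cvg_ex _) (@cauchy_cvg H F _ Fc).
exists v.
have key h : ip v h = g h.
  apply/eqP; rewrite -subr_eq0 -normr_le0.
  have small (e : R) : 0 < e -> `|ip v h - g h| <= e * (2 * N h).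
    move=> e0.
    have d2 : 0 < e ^+ 2 by rewrite exprn_gt0.
    have [n] := ltr_add_invr d2; rewrite add0r => nP.
    have ec : 0 < e%:C :> R[i] by rewrite ltcR.
    have [j [vj nj]] : exists j, `|v - x_ j| < e%:C /\ (n <= j)%N.
      have [M _ MP] := (proj1 (cvgrPdist_lt _ _) vP) _ ec.
      exists (maxn M n); split; last exact: leq_maxr.
      by apply: MP; exact: leq_maxl.
    have {}vj : N (v - x_ j) <= e by rewrite -lecR -NE ltW.
    have jn : j.+1%:R^-1 <= n.+1%:R^-1 :> R by rewrite lef_pV2 ?posrE ?ler_nat.
    have -> : ip v h - g h = ip (v - x_ j) h + (ip (x_ j) h - g h).
      by rewrite addrA; congr (_ - _); rewrite ipC (ipC _ h) (ipC (x_ j)) -ipD subrK.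
    apply: (le_trans (ler_normD _ _)); rewrite mulrCA mulr_natl mulr2n.
    rewrite (mulrC e); apply: lerD.
      by apply: (le_trans (ip_cs _ _)); rewrite [leLHS]mulrC ler_wpM2l.
    rewrite -(@ler_pXn2r _ 2) ?nnegrE ?mulr_ge0 ?(ltW e0) //.
    rewrite real_normK ?num_real //; apply: (le_trans (quad _ _)).
    rewrite exprMn ler_wpM2l ?sqr_ge0 //.
    by have := x_P j; rewrite -ltrBlDl => p; apply: (le_trans (ltW p)); apply: (le_trans jn); exact: ltW.
  have [h0|hn] := eqVneq (N h) 0.
    by have := small 1 ltr01; rewrite h0 !mulr0.
  have hp : 0 < N h by rewrite lt_def hn N_ge0.
  rewrite leNgt; apply/negP => p.
  have q0 : 0 < `|ip v h - g h| / (4 * N h) by rewrite divr_gt0 ?mulr_gt0.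
  have := small _ q0.
  have -> : `|ip v h - g h| / (4 * N h) * (2 * N h) = `|ip v h - g h| / 2 by field.
  lra.
move=> h; apply/eqP; rewrite eq_complex.
have -> : Re (f h) = Re '[v, h] by rewrite -[Re (f h)]/(g h) -key.
rewrite eqxx /=; have := key ('i *: h); rewrite /ip /g innerZr fZ.
by rewrite !(mulrC 'i) !ReiNIm => /oppr_inj ->.
Qed.
End Riesz.

Section BoundedOperators.
Variables (R : realType) (H : hilbertType R).

Definition bounded_op : {pred H -> H} := fun f =>
  `[< linear f /\ exists k : R[i], forall x, `|f x| <= k * `|x| >].

(* The algebra B(H) of bounded operators: multiplication is composition. It is
   only a [pzRingType], since B(H) is the zero ring when H = {0}. *)
Record bop : Type := BOp { bop_fun :> H -> H ; bop_subproof : bop_fun \in bounded_op }.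

HB.instance Definition _ := [isSub for bop_fun].
HB.instance Definition _ := [Choice of bop by <:].

Lemma bounded_opP f : reflect (linear f /\ exists2 k : R[i], 0 <= k & forall x, `|f x| <= k * `|x|)
  (f \in bounded_op).
Proof.
apply: (iffP idP) => [/asboolP[fl [k kP]]|[fl [k k0 kP]]]; last by apply/asboolP; split => //; exists k.
split => //; exists `|k| => // x; rewrite -[`|x|]normr_id -normrM.
apply: (le_trans (kP x)); rewrite ger0_norm //.
exact: le_trans (kP x).
Qed.

Fact bounded_op_submod_closed : submod_closed bounded_op.
Proof.
split=> [|a f g /bounded_opP[fl [k k0 kP]] /bounded_opP[gl [l l0 lP]]]; apply/bounded_opP.
  by split=> [b x y|]; [rewrite /= scaler0 addr0 | exists 0 => // x; rewrite normr0 mul0r].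
split=> [b x y|].
  rewrite -![(_ + _) _]/(_ *: _ _ + _ _) fl gl !scalerDr !scalerA (mulrC a b).
  by rewrite addrACA.
exists (`|a| * k + l) => [|x]; first by rewrite addr_ge0 ?mulr_ge0.
apply: (le_trans (ler_normD _ _)); rewrite mulrDl lerD //.
by rewrite normrZ -mulrA ler_wpM2l.
Qed.
HB.instance Definition _ :=
  GRing.isSubmodClosed.Build R[i] (H -> H) bounded_op bounded_op_submod_closed.
HB.instance Definition _ := [SubChoice_isSubLmodule of bop by <:].

Implicit Types a b c : bop.

Lemma bop_ext a b : (forall x, a x = b x) -> a = b.
Proof. by move=> E; apply: val_inj; apply/funext. Qed.

Lemma bop_linear a : linear a.
Proof. by have /bounded_opP[] := bop_subproof a. Qed.

HB.instance Definition _ a :=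
  GRing.isLinear.Build R[i] H H *:%R (bop_fun a) (bop_linear a).

Lemma bop_bounded a : exists2 k : R[i], 0 <= k & forall x, `|a x| <= k * `|x|.
Proof. by have /bounded_opP[] := bop_subproof a. Qed.

Lemma bop_continuous a : continuous a.
Proof.
apply: bounded_linear_continuous; apply/linear_boundedP.
have [k k0 kP] := bop_bounded a.
by near=> M => x; apply: (le_trans (kP x)); rewrite ler_wpM2r //; near: M; apply: nbhs_pinfty_ge; exact: ger0_real.
Unshelve. all: by end_near. Qed.

Lemma bopDE a b x : (a + b) x = a x + b x. Proof. by []. Qed.
Lemma bopNE a x : (- a) x = - a x. Proof. by []. Qed.
Lemma bopZE (k : R[i]) a x : (k *: a) x = k *: a x. Proof. by []. Qed.
Lemma bop0E x : (0 : bop) x = 0. Proof. by []. Qed.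

Fact bop_one_subproof : idfun \in bounded_op.
Proof. by apply/bounded_opP; split=> //; exists 1 => // x; rewrite mul1r. Qed.
Definition bop_one := BOp bop_one_subproof.

Fact bop_mul_subproof a b : a \o b \in bounded_op.
Proof.
apply/bounded_opP; split=> [k x y|]; first by rewrite /= !linearP.
have [k k0 kP] := bop_bounded a; have [l l0 lP] := bop_bounded b.
exists (k * l) => [|x /=]; first exact: mulr_ge0.
by apply: (le_trans (kP _)); rewrite -mulrA ler_wpM2l.
Qed.
Definition bop_mul a b := BOp (bop_mul_subproof a b).

Fact bop_mulA : associative bop_mul. Proof. by move=> a b c; exact: bop_ext. Qed.
Fact bop_mul1 : left_id bop_one bop_mul. Proof. by move=> a; exact: bop_ext. Qed.
Fact bop_1mul : right_id bop_one bop_mul. Proof. by move=> a; exact: bop_ext. Qed.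
Fact bop_mulDl : left_distributive bop_mul +%R.
Proof. by move=> a b c; exact: bop_ext. Qed.
Fact bop_mulDr : right_distributive bop_mul +%R.
Proof. by move=> a b c; apply: bop_ext => x; rewrite /= linearD. Qed.
HB.instance Definition _ := GRing.Zmodule_isPzRing.Build bop
  bop_mulA bop_mul1 bop_1mul bop_mulDl bop_mulDr.

Lemma bopME a b x : (a * b) x = a (b x). Proof. by []. Qed.
Lemma bop1E x : (1 : bop) x = x. Proof. by []. Qed.

(* The adjoint; the defining property [adjE] holds unconditionally by the Riesz
   representation theorem. *)
Definition adj a : bop := xget 0 [set b : bop | forall x y, '[b x, y] = '[x, a y]].

Lemma adjE a x y : '[adj a x, y] = '[x, a y].
Proof.
rewrite /adj; case: xgetP => [b _ /(_ x y)//|]; have [k k0 kP] := bop_bounded a.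
have /choice[f fP] : forall x, exists v, forall y, '[x, a y] = '[v, y].
  move=> {}x; apply: (@riesz_representation _ _ _ (`|x| * k)) => [c u v|u].
    by rewrite linearP inner_linear.
  by apply: (le_trans (cauchy_schwarz _ _)); rewrite -mulrA ler_wpM2l.
have fB : f \in bounded_op.
  apply/bounded_opP; split=> [c u v|].
    apply: inner_eql => z; rewrite -fP innerDl innerZl !fP.
    by rewrite innerDl innerZl.
  exists k => // u; have [->|/negPf fu] := eqVneq (f u) 0.
    by rewrite normr0 mulr_ge0.
  have fp : 0 < `|f u| by rewrite normr_gt0 fu.
  rewrite -(ler_pM2r fp) -expr2 -inner_norm -fP.
  rewrite -[leLHS]ger0_norm; last by rewrite fP inner_ge0.
  apply: (le_trans (cauchy_schwarz _ _)).
  by rewrite (mulrC k) -mulrA ler_wpM2l.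
by move=> /(_ (BOp fB)) []; move=> u v; rewrite /= fP.
Qed.

Lemma adjP a b : (forall x y, '[b x, y] = '[x, a y]) -> adj a = b.
Proof. by move=> E; apply: bop_ext => x; apply: inner_eql => y; rewrite adjE E. Qed.

Lemma adjEr a x y : '[x, adj a y] = '[a x, y].
Proof. by rewrite inner_conj adjE -inner_conj. Qed.
Lemma adjK a : adj (adj a) = a.
Proof. by apply: adjP => x y; rewrite adjEr. Qed.
Lemma adjM a b : adj (a * b) = adj b * adj a.
Proof. by apply: adjP => x y; rewrite !bopME !adjE. Qed.

Fact ketbra_subproof (x y : H) : (fun z => '[y, z] *: x) \in bounded_op.
Proof.
apply/bounded_opP; split=> [c u v|]; first by rewrite inner_linear scalerDl scalerA.
exists (`|y| * `|x|) => [|z]; first exact: mulr_ge0.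
by rewrite normrZ mulrAC ler_wpM2r // cauchy_schwarz.
Qed.
(* The rank-one operator x y^* : z |-> x <y, z>. *)
Definition ketbra x y := BOp (ketbra_subproof x y).

(* a <= b iff b - a is positive: over C, a nonnegative quadratic form forces
   self-adjointness. *)
Definition op_le a b := forall x, 0 <= '[x, (b - a) x].

Definition op_lub (D : set bop) s :=
  (forall a, D a -> op_le a s) /\
  forall b, (forall a, D a -> op_le a b) -> op_le s b.

Definition op_directed (D : set bop) :=
  D !=set0 /\ forall a b, D a -> D b -> exists c, [/\ D c, op_le a c & op_le b c].

(* Normality: preservation of least upper bounds of upward directed families of
   self-adjoint operators. *)
Definition normal_map (f : bop -> bop) := forall (D : set bop) s,
  (forall a, D a -> adj a = a) -> op_directed D ->
  op_lub D s -> op_lub (f @` D) (f s).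

Record normal_unital_endomorphism (f : bop -> bop) : Prop := {
  endo_linear : linear f;
  endoM : forall a b, f (a * b) = f a * f b;
  endo1 : f 1 = 1;
  endo_adj : forall a, f (adj a) = adj (f a);
  endo_normal : normal_map f
}.

End BoundedOperators.

Section E0.
Variables (R : realType) (S : nmodType) (H : hilbertType R).
Record E0_semigroup := {
  E0_map :> S -> bop H -> bop H;
  E0_endo : forall t, normal_unital_endomorphism (E0_map t);
  E0_zero : forall a, E0_map 0 a = a;
  E0_add : forall s t a, E0_map s (E0_map t a) = E0_map (s + t) a
}.
End E0.

Inductive time_domain := continuous_time | discrete_time.

Definition nonneg_pred (R : realType) : {pred R} := fun r => 0 <= r.
Fact nonneg_pred_addr_closed (R : realType) : addr_closed (@nonneg_pred R).
Proof. by split=> [|r s]; [exact: lexx | exact: addr_ge0]. Qed.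
Record nonneg_real (R : realType) := NonnegReal {
  nonneg_real_val :> R ; _ : nonneg_real_val \in @nonneg_pred R }.
HB.instance Definition _ (R : realType) := [isSub for @nonneg_real_val R].
HB.instance Definition _ (R : realType) := [Choice of nonneg_real R by <:].
HB.instance Definition _ (R : realType) :=
  GRing.SubChoice_isSubNmodule.Build R _ (nonneg_real R) (@nonneg_pred_addr_closed R).

Definition time_monoid (R : realType) (d : time_domain) : nmodType :=
  match d with continuous_time => nonneg_real R | discrete_time => nat end.

Section Arveson.
Variables (R : realType) (S : nmodType) (H : hilbertType R).
Variables (nz : exists z : H, z != 0) (theta : E0_semigroup S H).

Section Fiber.
Variable t : S.

Definition arveson_pred : {pred bop H} := fun x =>
  `[< forall a, theta t a * x = x * a >].

(* The argument [nz] (H is not {0}) is what makes the inner product determined by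
   <x, y> id = x^* y; it does not affect the carrier. *)
Record arveson (nz : exists z : H, z != 0) := Arveson {
  arveson_val :> bop H ; arveson_subproof : arveson_val \in arveson_pred }.

HB.instance Definition _ := [isSub for @arveson_val nz].
HB.instance Definition _ := [Choice of arveson nz by <:].

Fact arveson_submod_closed : submod_closed arveson_pred.
Proof.
split=> [|k x y /asboolP xP /asboolP yP]; apply/asboolP => a.
  by rewrite mulr0 mul0r.
rewrite mulrDr mulrDl yP; congr (_ + _).
apply: bop_ext => z; rewrite !(bopME, bopZE) linearZ /=.
by congr (k *: _); rewrite -!bopME xP.
Qed.
HB.instance Definition _ :=
  GRing.isSubmodClosed.Build R[i] (bop H) arveson_pred arveson_submod_closed.
HB.instance Definition _ := [SubChoice_isSubLmodule of arveson nz by <:].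

Implicit Types x y : arveson nz.

Lemma arvesonP x a : theta t a * (x : bop H) = (x : bop H) * a.
Proof. by have /asboolP := arveson_subproof x; apply. Qed.

Definition arveson_inner x y : R[i] :=
  xget 0 [set c | adj (x : bop H) * (y : bop H) = c *: (1 : bop H)].

Lemma arveson_innerE x y : adj (x : bop H) * (y : bop H) = arveson_inner x y *: (1 : bop H).
Proof.
rewrite /arveson_inner; case: xgetP => [c _ //|].
have [z0 z0n] := nz.
have com a : adj (x : bop H) * (y : bop H) * a = a * (adj (x : bop H) * (y : bop H)).
  rewrite -mulrA -arvesonP mulrA mulrA; congr (_ * _).
  rewrite -[a in RHS]adjK -adjM -arvesonP adjM.
  by rewrite -(endo_adj (E0_endo theta t)) adjK.
move: (_ * _) com => T com.
move=> /(_ ('[z0, T z0] / '[z0, z0])) []; apply: bop_ext => u /=.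
have z00 : '[z0, z0] != 0 by rewrite inner_norm sqrf_eq0 normr_eq0.
have /(congr1 (fun f : bop H => f z0)) := com (ketbra u z0).
rewrite !bopME /= linearZ /= => E.
apply: (scalerI z00); rewrite E scalerA; congr (_ *: _).
by rewrite mulrC divfK.
Qed.

Lemma arveson_innerM x y z w : '[x z, y w] = arveson_inner x y * '[z, w].
Proof.
by rewrite -adjEr -[adj _ _]/((adj (x : bop H) * (y : bop H)) w) arveson_innerE innerZr.
Qed.

Let z0 := projT1 (cid nz).
Let z0n : 0 < `|z0|. Proof. by rewrite normr_gt0; exact: projT2 (cid nz). Qed.

Definition arveson_norm x : R[i] := sqrtC (arveson_inner x x).

Lemma arveson_normE x z : `|x z| = arveson_norm x * `|z|.
Proof.
have E w : `|x w| ^+ 2 = arveson_inner x x * `|w| ^+ 2.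
  by rewrite -!inner_norm arveson_innerM.
have c0 : 0 <= arveson_inner x x.
  by rewrite -(pmulr_lge0 _ (exprn_gt0 2 z0n)) -E exprn_ge0.
apply/eqP; rewrite -(@eqrXn2 _ 2) ?mulr_ge0 ?sqrtC_ge0 //.
by rewrite E exprMn sqrtCK.
Qed.

Fact arveson_normD x y : arveson_norm (x + y) <= arveson_norm x + arveson_norm y.
Proof.
by rewrite -(ler_pM2r z0n) mulrDl -!arveson_normE ler_normD.
Qed.

Fact arveson_normZ (k : R[i]) x : arveson_norm (k *: x) = `|k| * arveson_norm x.
Proof.
apply: (mulIf (lt0r_neq0 z0n)); rewrite -mulrA -!arveson_normE.
by rewrite -normrZ.
Qed.

Fact arveson_norm0 x : arveson_norm x = 0 -> x = 0.
Proof.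
move=> x0; apply: val_inj; apply: bop_ext => z.
by apply/eqP; rewrite -normr_eq0 arveson_normE x0 mul0r.
Qed.

HB.instance Definition _ := Lmodule_isNormed.Build R[i] (arveson nz)
  arveson_normD arveson_normZ arveson_norm0.

Lemma arveson_evalE x z : `|x z| = `|x| * `|z|.
Proof. exact: arveson_normE. Qed.

Lemma arveson_norm_le x (k : R[i]) : (forall z, `|x z| <= k * `|z|) -> `|x| <= k.
Proof. by move=> /(_ z0); rewrite arveson_evalE ler_pM2r. Qed.

Fact arveson_complete (F : set_system (arveson nz)) :
  ProperFilter F -> cauchy F -> cvg F.
Proof.
move=> FF /cauchyP Fc.
pose ev z (x : arveson nz) : H := x z.
have evc z : cauchy (ev z @ F).
  apply: cauchy_exP => e e0.
  have d0 : 0 < e / (`|z| + 1) by rewrite divr_gt0 // ltr_wpDl.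
  have [x xF] := Fc _ d0.
  exists (ev z x); suff : F [set y | ball (ev z x) e (ev z y)] by [].
  apply: filterS xF => y /=; rewrite -!ball_normE /=.
  rewrite -[ev z x - ev z y]/((x - y) z) arveson_evalE.
  rewrite ltr_pdivlMr ?ltr_wpDl //; apply: le_lt_trans.
  by rewrite ler_wpM2l // lerDl.
have Lex : forall z : H, exists l : H, ev z @ F --> l.
  by move=> z; apply/cvg_ex; apply: cauchy_cvg.
have [L LP] := choice Lex.
have L_lin : linear L.
  move=> k u v; have h : ev (k *: u + v) @ F --> k *: L u + L v.
    rewrite (_ : ev (k *: u + v) = fun x => k *: ev u x + ev v x); last first.
      by apply/funext => x; rewrite /ev linearP.
    by apply: cvgD; [apply: cvgZl_tmp|]; exact: LP.
  exact: (cvg_unique (@norm_hausdorff _ H) (LP _) h).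
have L_close (x : arveson nz) (e : R[i]) : F [set y | `|x - y| <= e] ->
    forall z, `|x z - L z| <= e * `|z|.
  move=> xe z; apply/ler_addgt0Pr => d d0.
  have [y [xy yL]] : exists y, `|x - y| <= e /\ `|L z - ev z y| < d.
    apply: (@filter_ex _ F FF); apply: filterI => //.
    by have /cvgrPdist_lt/(_ _ d0) := LP z.
  rewrite -(subrKA (y z)); apply: (le_trans (ler_normD _ _)).
  apply: lerD; last by rewrite distrC ltW.
  by rewrite -[x z - y z]/((x - y) z) arveson_evalE ler_wpM2r.
have L_bnd : L \in @bounded_op R H.
  have [x xF] := Fc _ ltr01; apply/bounded_opP; split=> //.
  exists (`|x| + 1) => [|z]; first exact: addr_ge0.
  rewrite -[L z](subKr (x z)); apply: (le_trans (ler_normB _ _)).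
  rewrite mulrDl arveson_evalE lerD // L_close //.
  by apply: filterS xF => y; rewrite -ball_normE => /ltW.
have L_arv : BOp L_bnd \in arveson_pred.
  apply/asboolP => a; apply: bop_ext => z; rewrite !bopME /=.
  have h : ev (a z) @ F --> theta t a (L z).
    rewrite (_ : ev (a z) = theta t a \o ev z); last first.
      by apply/funext => x; rewrite /ev /= -!bopME arvesonP.
    by apply: continuous_cvg; [exact: bop_continuous | exact: LP].
  exact: (cvg_unique (@norm_hausdorff _ H) h (LP _)).
apply/cvg_ex; exists (Arveson nz L_arv); apply/cvgrPdist_le => e e0.
have e2 : 0 < e / 2 by rewrite divr_gt0.
have [x xF] := Fc _ e2.
have xe : F [set y | `|x - y| <= e / 2].
  by apply: filterS xF => y; rewrite -ball_normE => /ltW.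
apply: (filterS _ (xe)) => y xy; rewrite distrC -(subrKA x) [e]splitr.
apply: (le_trans (ler_normD _ _)); rewrite distrC lerD //.
by apply: arveson_norm_le => z; apply: L_close.
Qed.
HB.instance Definition _ :=
  Uniform_isComplete.Build (arveson nz) arveson_complete.

Fact arveson_inner_conj x y : arveson_inner y x = (arveson_inner x y)^*.
Proof.
have zz : '[z0, z0] != 0 by rewrite inner_norm sqrf_eq0 (lt0r_neq0 z0n).
apply: (mulIf zz); rewrite -arveson_innerM inner_conj arveson_innerM rmorphM /=.
by rewrite -inner_conj.
Qed.
Fact arveson_inner_linear x (k : R[i]) y w :
  arveson_inner x (k *: y + w) = k * arveson_inner x y + arveson_inner x w.
Proof.
have zz : '[z0, z0] != 0 by rewrite inner_norm sqrf_eq0 (lt0r_neq0 z0n).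
apply: (mulIf zz); rewrite mulrDl -mulrA -!arveson_innerM.
by rewrite -inner_linear.
Qed.
Fact arveson_inner_norm x : arveson_inner x x = `|x| ^+ 2.
Proof. by rewrite -[RHS]/(arveson_norm x ^+ 2) sqrtCK. Qed.
HB.instance Definition _ := CompleteNormedModule_isHilbert.Build R (arveson nz)
  arveson_inner_conj arveson_inner_linear arveson_inner_norm.
End Fiber.

Fact arveson_mul_subproof t s (x : arveson t nz) (y : arveson s nz) :
  (x : bop H) * (y : bop H) \in arveson_pred (t + s).
Proof.
apply/asboolP => a.
by rewrite -(E0_add theta) mulrA arvesonP -mulrA arvesonP mulrA.
Qed.
Definition arveson_mul t s (x : arveson t nz) (y : arveson s nz) :
  arveson (t + s) nz := Arveson nz (arveson_mul_subproof x y).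
End Arveson.

Section Bhat.
Variables (R : realType) (S : nmodType) (H : hilbertType R).
Variables (theta : E0_semigroup S H) (xi : H).

Section Fiber.
Variable t : S.

Definition bhat_pred : {pred H} := fun x => x \in range (theta t (ketbra xi xi)).

(* The range of theta_t(xi xi^* ). The argument [unit_xi] makes xi xi^* a
   projection, so that the range is closed. *)
Record bhat (unit_xi : `|xi| = 1) := Bhat {
  bhat_val :> H ; bhat_subproof : bhat_val \in bhat_pred }.

Variable unit_xi : `|xi| = 1.

HB.instance Definition _ := [isSub for @bhat_val unit_xi].
HB.instance Definition _ := [Choice of bhat unit_xi by <:].

Fact bhat_submod_closed : submod_closed bhat_pred.
Proof.
split=> [|k x y /set_mem[u _ <-] /set_mem[v _ <-]]; apply/mem_set.
  by exists 0; rewrite // linear0.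
by exists (k *: u + v); rewrite // linearP.
Qed.
HB.instance Definition _ :=
  GRing.isSubmodClosed.Build R[i] H bhat_pred bhat_submod_closed.
HB.instance Definition _ := [SubChoice_isSubLmodule of bhat unit_xi by <:].

Lemma ketbra_idem : ketbra xi xi * ketbra xi xi = ketbra xi xi.
Proof.
apply: bop_ext => z; rewrite bopME /= innerZr inner_norm unit_xi.
by rewrite expr1n mulr1.
Qed.

Lemma bhat_predP x : reflect (theta t (ketbra xi xi) x = x) (x \in bhat_pred).
Proof.
apply: (iffP idP) => [/set_mem[u _ <-]|E]; last by apply/mem_set; exists x.
by rewrite -bopME -(endoM (E0_endo theta t)) ketbra_idem.
Qed.

Implicit Types x y : bhat unit_xi.

Definition bhat_norm x : R[i] := `|x : H|.
Fact bhat_normD x y : bhat_norm (x + y) <= bhat_norm x + bhat_norm y.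
Proof. exact: ler_normD. Qed.
Fact bhat_normZ (k : R[i]) x : bhat_norm (k *: x) = `|k| * bhat_norm x.
Proof. exact: normrZ. Qed.
Fact bhat_norm0 x : bhat_norm x = 0 -> x = 0.
Proof. by move=> /normr0_eq0 x0; apply: val_inj. Qed.
HB.instance Definition _ := Lmodule_isNormed.Build R[i] (bhat unit_xi)
  bhat_normD bhat_normZ bhat_norm0.

Fact bhat_complete (F : set_system (bhat unit_xi)) :
  ProperFilter F -> cauchy F -> cvg F.
Proof.
move=> FF /cauchyP Fc.
have vc : cauchy (@bhat_val unit_xi @ F).
  apply: cauchy_exP => e e0; have [x xF] := Fc _ e0.
  exists (bhat_val x).
  suff : F [set y | ball (bhat_val x) e (bhat_val y)] by [].
  by apply: filterS xF => y; rewrite /= -!ball_normE.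
have [w wP] := proj1 (cvg_ex _) (@cauchy_cvg H _ _ vc).
have wB : w \in bhat_pred.
  apply/bhat_predP.
  set p := theta t _; have h : @bhat_val unit_xi @ F --> p w.
    rewrite (_ : @bhat_val _ = p \o @bhat_val unit_xi); last first.
      by apply/funext => x /=; have /bhat_predP := bhat_subproof x.
    by apply: continuous_cvg; [exact: bop_continuous | exact: wP].
  exact: (cvg_unique (@norm_hausdorff _ H) h wP).
apply/cvg_ex; exists (Bhat unit_xi wB); apply/cvgrPdist_le => e e0.
by have /cvgrPdist_le/(_ _ e0) := wP.
Qed.
HB.instance Definition _ :=
  Uniform_isComplete.Build (bhat unit_xi) bhat_complete.

Definition bhat_inner x y : R[i] := '[(x : H), (y : H)].
Fact bhat_inner_conj x y : bhat_inner y x = (bhat_inner x y)^*.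
Proof. exact: inner_conj. Qed.
Fact bhat_inner_linear x (k : R[i]) y w :
  bhat_inner x (k *: y + w) = k * bhat_inner x y + bhat_inner x w.
Proof. exact: inner_linear. Qed.
Fact bhat_inner_norm x : bhat_inner x x = `|x| ^+ 2.
Proof. exact: inner_norm. Qed.
HB.instance Definition _ := CompleteNormedModule_isHilbert.Build R (bhat unit_xi)
  bhat_inner_conj bhat_inner_linear bhat_inner_norm.
End Fiber.

Variable unit_xi : `|xi| = 1.

Fact bhat_mul_subproof s t (x : bhat s unit_xi) (y : bhat t unit_xi) :
  theta t (ketbra (x : H) xi) (y : H) \in bhat_pred (s + t).
Proof.
apply/(bhat_predP _ unit_xi); rewrite (addrC s t) -(E0_add theta) -bopME.
rewrite -(endoM (E0_endo theta t)); congr (theta t _ _).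
apply: bop_ext => z; rewrite bopME /= linearZ /=.
by have /(bhat_predP _ unit_xi) -> := bhat_subproof x.
Qed.
(* (x_s, y_t) |-> theta_t(x_s xi^* ) y_t *)
Definition bhat_mul s t (x : bhat s unit_xi) (y : bhat t unit_xi) :
  bhat (s + t) unit_xi := Bhat unit_xi (bhat_mul_subproof x y).
End Bhat.

Definition unitary (R : realType) (U V : hilbertType R) (u : U -> V) :=
  [/\ linear u, bijective u & forall x y, '[u x, u y] = '[x, y]].

(* Main.v *)
Require Import Defs.
From mathcomp Require Import all_boot all_order all_algebra.
From mathcomp Require Import complex.
From mathcomp Require Import boolp classical_sets functions reals topology normedtype.
Import Order.TTheory GRing.Theory Num.Theory.
Local Open Scope ring_scope.

(** The unitary is evaluation at the unit vector: [u_t x = x xi]. It lands in the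
    Bhat fiber because [theta_t (xi xi^* ) x xi = x (xi xi^* ) xi = x xi], and its
    inverse sends [h] to the operator [z |-> theta_t (z xi^* ) h], which is
    bounded since [<theta_t (z xi^* ) h, theta_t (w xi^* ) h> = <z, w> <h, h>].
    The order of the factors is reversed because
    [theta_t ((y xi) xi^* ) (x xi) = x ((y xi) xi^* ) xi = x (y xi)]. *)

Section Ketbra.
Context {R : realType} {H : hilbertType R}.
Implicit Types (x y z w : H) (a : bop H).

Lemma ketbra_linearl y : linear (fun x => ketbra x y : bop H).
Proof.
move=> k x z; apply: bop_ext => w.
by rewrite bopDE bopZE /= scalerDr !scalerA mulrC.
Qed.

Lemma ketbra_unit x y : `|y| = 1 -> ketbra x y y = x.
Proof. by move=> y1; rewrite /= inner_norm y1 expr1n scale1r. Qed.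

Lemma mul_ketbra a x y : a * ketbra x y = ketbra (a x) y.
Proof. by apply: bop_ext => z; rewrite bopME /= linearZ. Qed.

Lemma adj_ketbra x y : adj (ketbra x y) = ketbra y x.
Proof.
apply: adjP => z w /=.
by rewrite innerZl innerZr -inner_conj mulrC.
Qed.

Lemma ketbra_mul x y z w : ketbra x y * ketbra z w = '[y, z] *: ketbra x w.
Proof.
by apply: bop_ext => v; rewrite bopME bopZE /= innerZr scalerA mulrC.
Qed.

End Ketbra.

Section BhatToArveson.
Context {R : realType} {S : nmodType} {H : hilbertType R}.
Context (theta : E0_semigroup S H) (xi : H) (unit_xi : `|xi| = 1).
Context (nz : exists z : H, z != 0) {t : S}.
Implicit Types (x : arveson theta t nz) (h : bhat theta t unit_xi).

(** Taking [z = xi] puts [x xi] in the Bhat fiber, arbitrary [z] recovers [x] from [x xi], and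
    [z = y xi] gives the reversed product. *)
Lemma arveson_ketbra x (z : H) : theta t (ketbra z xi) (x xi) = x z.
Proof. by rewrite -bopME arvesonP bopME ketbra_unit. Qed.

Fact arveson_eval_subproof x : (x xi : H) \in bhat_pred theta xi t.
Proof. by apply/(bhat_predP _ _ unit_xi); rewrite arveson_ketbra. Qed.

Definition arveson_eval x : bhat theta t unit_xi :=
  Bhat unit_xi (arveson_eval_subproof x).

(** As [theta t] is a *-homomorphism, moving the first operator across leaves [theta t] of (z xi^*
    )^* (w xi^* ) = <z, w> xi xi^*, and [theta t (ketbra xi xi)] fixes [h]. *)
Lemma bhat_ketbra_inner h (z w : H) :
  '[theta t (ketbra z xi) h, theta t (ketbra w xi) h] = '[z, w] * '[h, h].
Proof.
rewrite -adjEr -(endo_adj (E0_endo theta t)) -bopME -(endoM (E0_endo theta t)).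
rewrite adj_ketbra ketbra_mul.
have /(bhat_predP _ _ unit_xi) hE := bhat_subproof h.
have thZ k a : theta t (k *: a) = k *: theta t a.
  exact: (scalable_linear (endo_linear (E0_endo theta t))).
by rewrite thZ bopZE innerZr hE.
Qed.

Fact bhat_op_subproof h : (fun z => theta t (ketbra z xi) h) \in @bounded_op R H.
Proof.
apply/bounded_opP; split=> [k z w|].
  by rewrite ketbra_linearl (endo_linear (E0_endo theta t)).
exists `|h| => // z.
(* After squaring, the bound is an equality: [bhat_ketbra_inner] with [w = z]. *)
rewrite -(@ler_pXn2r _ 2) ?nnegrE ?mulr_ge0 //.
by rewrite exprMn -!inner_norm bhat_ketbra_inner mulrC.
Qed.

Fact bhat_op_arveson h : BOp (bhat_op_subproof h) \in arveson_pred theta t.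
Proof.
apply/asboolP => a; apply: bop_ext => z; rewrite !bopME /=.
by rewrite -bopME -(endoM (E0_endo theta t)) mul_ketbra.
Qed.

Definition bhat_op h : arveson theta t nz := Arveson nz (bhat_op_arveson h).

Lemma arveson_evalK : cancel arveson_eval bhat_op.
Proof. by move=> x; apply: val_inj; apply: bop_ext => z; exact: arveson_ketbra. Qed.

Lemma bhat_opK : cancel bhat_op arveson_eval.
Proof. by move=> h; apply: val_inj; apply/(bhat_predP _ _ unit_xi)/bhat_subproof. Qed.

Lemma arveson_eval_unitary : unitary arveson_eval.
Proof.
split=> [k x y||x y]; first exact: val_inj.
  by exists bhat_op; [exact: arveson_evalK | exact: bhat_opK].
(* Since x^* y is the scalar <x, y>, evaluating at a unit vector preserves inner products. *)
rewrite -[LHS]/('[x xi, y xi]) arveson_innerM inner_norm unit_xi.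
by rewrite expr1n mulr1.
Qed.

End BhatToArveson.

Theorem mainTheorem4 (R : realType) (d : time_domain) (H : hilbertType R)
    (nz : exists z : H, z != 0) (theta : E0_semigroup (time_monoid R d) H)
    (xi : H) (unit_xi : `|xi| = 1) :
  exists u : forall t, arveson theta t nz -> bhat theta t unit_xi,
    (forall t, unitary (u t)) /\
    forall s t (x : arveson theta t nz) (y : arveson theta s nz),
      u (t + s) (arveson_mul x y) = bhat_mul (u s y) (u t x) :> H.
Proof.
exists (fun t => arveson_eval theta xi unit_xi nz); split=> [t|s t x y].
  exact: arveson_eval_unitary.
(* Both sides are [x (y xi)]; they are compared in [H] because the fibers over [t + s] and [s + t]
   are distinct types. *)
by rewrite /= arveson_ketbra.
Qed.
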